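(* Let $n>1$ be an integer, let $a_k>0$ and $c_k,d_k,\beta_k\in\mathbb R$ ($k=1,\dots,n$) with $\sum_{k=1}^n a_k=1$, let $p\in[1,+\infty]$, and let $G:L_p[0,1]\to L_p[0,1]$ be the similarity operator with these parameters. If $$\sum_{k=1}^n a_k|d_k|^p<1\ \ (\text{when }1\le p<+\infty)\qquad\text{or}\qquad \max_{1\le k\le n}|d_k|<1\ \ (\text{when }p=+\infty),$$ then there exists a unique function $f\in L_p[0,1]$ satisfying $G(f)=f$.
   Context: Set $\alpha_1=0$ and $\alpha_k=\sum_{l=1}^{k-1}a_l$ for $k=2,\dots,n+1$, so that $0=\alpha_1<\alpha_2<\dots<\alpha_{n+1}=1$. The similarity operator $G$ with parameters $\{a_k\},\{c_k\},\{d_k\},\{\beta_k\}$ acts on (classes of) real functions $f\in L_p[0,1]$ by $$G(f)(x)=c_k\,t+d_k\,f(t)+\beta_k,\qquad x=a_kt+\alpha_k\in(\alpha_k,\alpha_{k+1}),\quad t=\frac{x-\alpha_k}{a_k}\in(0,1),\quad k=1,\dots,n.$$ *)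

(* Defs.v *)
From HB Require Import structures.
From mathcomp Require Import all_boot all_order all_algebra.
From mathcomp Require Import all_classical all_reals all_analysis.
From mathcomp Require Import measurable_realfun ess_sup_inf ring lra.

Set Implicit Arguments.
Unset Strict Implicit.
Unset Printing Implicit Defensive.

Import Order.TTheory GRing.Theory Num.Theory.
Import numFieldNormedType.Exports.

Local Open Scope classical_set_scope.
Local Open Scope ring_scope.

Section lebesgue01.
Context (R : realType).

(* L_p[0,1] is LspaceType lebesgue01: its elements are classes of Borel functions
   on R, and two functions that agree a.e. on [0,1] give the same class *)
Definition lebesgue01 : set (measurableTypeR R) -> \bar R :=
  mrestr (@lebesgue_measure R) (measurable_itv `[0, 1]).
HB.instance Definition _ := Measure.on lebesgue01.

#[global] Instance ae_lebesgue01_filter :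
  Filter (nbhs (almost_everywhere lebesgue01)).
Proof. exact: ae_filter_ringOfSetsType. Qed.

End lebesgue01.

Section Lspace_class.
Context d (T : measurableType d) (R : realType).
Variables (mu : {measure set T -> \bar R}) (p : \bar R) (p1 : (1 <= p)%E).
Local Open Scope quotient_scope.

Lemma ae_eq_Lnorm (f g : T -> R) :
  measurable_fun setT f -> measurable_fun setT g -> f = g %[ae mu] ->
  Lnorm mu p (EFin \o f) = Lnorm mu p (EFin \o g).
Proof.
move=> mf mg fg.
rewrite unlock /Lnorm; case: p p1 => [r r1||//].
- have mpow (h : T -> R) : measurable_fun setT h ->
      measurable_fun setT ((fun x : T => `| (EFin \o h) x | `^ r)%E : T -> \bar R).
    move=> mh; apply: (measurableT_comp (measurable_poweR _)).
    by apply: measurableT_comp => //; exact/measurable_EFinP.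
  congr (_ `^ _)%E; apply: ge0_ae_eq_integral => //; [exact: mpow|exact: mpow|
    by move=> x _; exact: poweR_ge0|by move=> x _; exact: poweR_ge0|].
  by apply: filterS fg => x /= /(_ I) -> _.
- move=> _; case: ifP => // _; apply: eq_ess_sup.
  by apply: filterS fg => x /= /(_ I) ->.
Qed.

(* R and measurableTypeR R carry the same measurable sets, but only the latter
   is accepted as codomain by LspaceType *)
Let mfun_typeR (f : {mfun T >-> R}) : {mfun T >-> measurableTypeR R} :=
  HB.pack (f : T -> measurableTypeR R)
    (isMeasurableFun.Build _ _ T (measurableTypeR R) f (measurable_funPT f)).

Definition mfun_class (f : {mfun T >-> R}) :
    {mfun_ mu, T >-> measurableTypeR R} :=
  \pi_({mfun_ mu, T >-> measurableTypeR R}) (mfun_typeR f).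

Lemma mfun_classE (f : {mfun T >-> R}) : (mfun_class f : T -> R) = f %[ae mu].
Proof.
have /eqmodP/asboolP := reprK (mfun_class f).
by [].
Qed.

Lemma finite_norm_mfun_class (f : LfunType mu p1) :
  finite_norm mu p (mfun_class f : T -> R).
Proof.
rewrite /finite_norm (ae_eq_Lnorm _ _ (mfun_classE f))//.
- exact: Lfunction_finite.
- exact: (measurable_funPT (repr (mfun_class f))).
Qed.

Definition Lspace_class (f : LfunType mu p1) : LspaceType mu p1 :=
  HB.pack (mfun_class f)
    (isFinLebesgue.Build d T R mu p p1 (mfun_class f) (finite_norm_mfun_class f)).

Lemma Lspace_classE (f : LfunType mu p1) :
  (Lspace_class f : T -> R) = f %[ae mu].
Proof. exact: mfun_classE. Qed.

Lemma Lspace_Lfun (f : LspaceType mu p1) : (f : T -> R) \in Lfun mu p.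
Proof.
rewrite inE; apply/andP; split; rewrite inE/=; last exact: Lebesgue_finite.
exact: (@measurable_funPT _ _ _ _ (repr (f : {mfun_ mu, T >-> measurableTypeR R}))).
Qed.

Lemma Lspace_eqP (f g : LspaceType mu p1) :
  f = g <-> (f : T -> R) = g %[ae mu].
Proof.
split=> [->|]; first exact: ae_eq_refl.
case: f => f [[hf]]; case: g => g [[hg]] /= fg.
have fgE : f = g.
  rewrite -(reprK f) -(reprK g); apply/eqP; rewrite eqmodE; exact/asboolP.
by subst g; congr LebesgueSpace.Pack; congr LebesgueSpace.Class; congr isFinLebesgue.Axioms_; exact: bool_irrelevance.
Qed.

End Lspace_class.

Section lebesgue01_lemmas.
Context (R : realType).
Local Notation mu := (@lebesgue01 R).

Lemma lebesgue01_setT : mu setT = 1%E.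
Proof.
by rewrite /lebesgue01 /mrestr setTI lebesgue_measure_itv/= lte01 oppr0 adde0.
Qed.

Lemma measurable_affine (a b : R) :
  measurable_fun setT (fun x : R => (x - b) / a).
Proof. by apply: measurable_funM => //; exact: measurable_funB. Qed.

Lemma lebesgue_measure_affine (a b : R) (A : set R) : 0 < a -> measurable A ->
  lebesgue_measure ((fun x : R => (x - b) / a) @^-1` A) =
  (a%:E * lebesgue_measure A)%E.
Proof.
move=> a0 mA.
have mphi : measurable_fun setT
    ((fun x => (x - b) / a) : measurableTypeR R -> measurableTypeR R).
  exact: measurable_affine.
have ai0 : 0 <= a^-1 by rewrite invr_ge0 ltW.
pose mphi_mixin := isMeasurableFun.Build _ _ _ _ _ mphi.
pose phi : {mfun measurableTypeR R >-> measurableTypeR R} :=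
  HB.pack (fun x : R => (x - b) / a) mphi_mixin.
pose nu : {measure set (measurableTypeR R) -> \bar R} :=
  mscale (NngNum ai0) (pushforward lebesgue_measure phi).
have := @lebesgue_measure_unique R (nu mphi) _ A mA.
rewrite /nu /mscale/= /pushforward/= => ->.
- by rewrite muleA -EFinM divff ?mul1e ?gt_eqF.
move=> _ [[x y] _ <-] /=; rewrite /mscale/= /pushforward/=.
rewrite [X in (_ * lebesgue_measure X)%E](_ : _ =
    `](x * a + b), (y * a + b)]%classic); last first.
  apply/seteqP; split => z /=; rewrite !in_itv/=; rewrite ltr_pdivlMr// ler_pdivrMr//;
  by rewrite ltrBrDr lerBlDr.
rewrite !lebesgue_measure_itv/= !lte_fin ltrD2r ltr_pM2r//.
case: ifPn => _; last by rewrite mule0.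
by rewrite -!EFinB -EFinM; congr EFin; field; rewrite gt_eqF.
Qed.

Lemma ae_affine (a b : R) (P : set R) : 0 < a ->
  (\forall x \ae mu, P x) ->
  \forall x \ae mu, b < x < b + a -> P ((x - b) / a).
Proof.
move=> a0 [N [mN N0 PN]].
pose s x : R := (x - b) / a.
have ms : measurable_fun setT s by exact: measurable_affine.
have mN01 : measurable (N `&` `[0, 1]) by apply: measurableI.
exists (s @^-1` (N `&` `[0, 1])); split.
- by rewrite -[X in measurable X]setTI; exact: ms.
- apply/eqP; rewrite -measure_le0 -[leRHS](mule0 a%:E) -N0.
  rewrite -(lebesgue_measure_affine b a0 mN01).
  apply: le_measure; rewrite ?inE//.
  + apply: measurableI => //; rewrite -[X in measurable X]setTI; exact: ms.
  + rewrite -[X in measurable X]setTI; exact: ms.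
- move=> x /= /not_implyP[/andP[bx xb] nP]; split; first exact: PN.
  rewrite in_itv/= /s divr_ge0 ?subr_ge0 ?(ltW bx) ?(ltW a0)//=.
  by rewrite ler_pdivrMr// mul1r lerBlDl ltW.
Qed.

Lemma Lfun_bounded (p : \bar R) (h : R -> R) (M : R) : (1 <= p)%E ->
  measurable_fun setT h -> (forall x, `|h x| <= M) -> h \in Lfun mu p.
Proof.
move=> p1 mh hM; rewrite inE; apply/andP; split; rewrite inE//=.
rewrite /finite_norm unlock /Lnorm; case: p p1 => [r r1||//].
- apply: poweR_lty.
  apply: (@le_lt_trans _ _ (\int[mu]_x (M `^ r)%:E)%E); last first.
    rewrite integral_cst// [X in (_ * X)%E](_ : _ = 1%E) ?mule1 ?ltry//.
    exact: lebesgue01_setT.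
  apply: ge0_le_integral => //.
  + by move=> x _; exact: poweR_ge0.
  + apply: (measurableT_comp (measurable_poweR _)).
    by apply: measurableT_comp => //; exact/measurable_EFinP.
  + move=> x _ /=; rewrite lee_fin; apply: ge0_ler_powR => //.
    * by rewrite (le_trans ler01).
    * by rewrite nnegrE (le_trans _ (hM x)).
- move=> _; case: ifP => _ //; apply: (@le_lt_trans _ _ M%:E); last exact: ltry.
  by apply/ess_supP; apply: aeW => x /=; rewrite lee_fin.
Qed.

Lemma Lfun_affine (p : \bar R) (f : R -> R) (a b : R) : (1 <= p)%E -> 0 < a ->
  f \in Lfun mu p ->
  (fun x => if b < x < b + a then f ((x - b) / a) else 0) \in Lfun mu p.
Proof.
move=> p1 a0; rewrite inE => /andP[/[!inE]/= mf ff].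
pose s x : R := (x - b) / a; pose I := `]b, (b + a)[%classic.
have ms : measurable_fun setT s by exact: measurable_affine.
have sI : I = s @^-1` `]0, 1[.
  apply/seteqP; split => z /=; rewrite !in_itv/= /s ltr_pdivlMr// ltr_pdivrMr//;
  by rewrite mul0r mul1r subr_gt0 ltrBlDl.
have mI : measurable (I : set R) by exact: measurable_itv.
pose g x := if b < x < b + a then f (s x) else 0.
have gE : g = (f \o s) \_ I.
  apply/funext => x; rewrite /g patchE/= mem_setE.
  by rewrite in_itv.
have mg : measurable_fun setT g.
  rewrite gE; apply/(measurable_restrictT _ mI).
  exact/measurable_funTS/measurableT_comp.
apply/andP; split; rewrite inE//=.
move: ff; rewrite /finite_norm unlock /Lnorm; case: p p1 => [r r1||//].
- have r0 : 0 < r by rewrite (lt_le_trans ltr01).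
  pose h x := (`|(f x)%:E| `^ r)%E.
  have mh : measurable_fun setT h.
    apply: (measurableT_comp (measurable_poweR _)).
    by apply: measurableT_comp => //; exact/measurable_EFinP.
  have h0 x : (0 <= h x)%E by exact: poweR_ge0.
  move=> ff.
  have hoo : (\int[mu]_x h x < +oo)%E.
    by apply: (@lty_poweRy _ _ r^-1) ff; rewrite gt_eqF ?invr_gt0.
  apply: poweR_lty; apply: (@le_lt_trans _ _ (a%:E * \int[mu]_x h x)%E); last first.
    by rewrite lte_mul_pinfty// lee_fin ltW.
  rewrite [leLHS](_ : _ = \int[mu]_(x in I) (h \o s) x)%E; last first.
    rewrite [RHS]integral_mkcond; apply: eq_integral => x _.
    rewrite patchE /= /g mem_setE/= in_itv/=; case: ifPn => // _.
    by rewrite normr0 powR0// gt_eqF.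
  apply: (@le_trans _ _ (\int[lebesgue_measure]_(x in I) (h \o s) x)%E).
    apply: ge0_le_measure_integral => //.
    + move=> S mS; apply: le_measure; rewrite ?inE//.
      exact: measurableI.
    + by move=> x; exact: h0.
    + exact: (measurableT_comp mh ms).
  rewrite sI -[leLHS](@ge0_integral_pushforward _ _ (measurableTypeR R)
     (measurableTypeR R))//=; last first.
    exact: measurable_funTS.
  have a0' := ltW a0.
  rewrite [leLHS](_ : _ =
      \int[mscale (NngNum a0') mu]_(y in `]0%R, 1%R[) h y)%E; last first.
    pose mphi_mixin := isMeasurableFun.Build _ _ (measurableTypeR R) (measurableTypeR R) _ ms.
    pose phi : {mfun measurableTypeR R >-> measurableTypeR R} :=
      HB.pack s mphi_mixin.
    apply: (@eq_measure_integral _ _ _ _ _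
      (pushforward lebesgue_measure phi)) => A mA A01.
    rewrite [RHS](_ : _ = a%:E * lebesgue_measure (A `&` `[0%R, 1%R]))%E;
      last by [].
    rewrite setIidl; first exact: lebesgue_measure_affine.
    apply: (subset_trans A01) => x /=; rewrite !in_itv/= => /andP[x0 x1].
    by rewrite !ltW.
  rewrite ge0_integral_mscale//; last exact: measurable_funTS.
  apply: lee_wpmul2l; first by rewrite lee_fin.
  exact: ge0_subset_integral.
- move=> _; case: ifP => // _ fy.
  have [M fM] : exists M : R, \forall x \ae mu, `|f x| <= M.
    exact: ess_supr_bounded fy.
  apply: (@le_lt_trans _ _ (Num.max 0 M)%:E); last exact: ltry.
  apply/ess_supP; have := ae_affine b a0 fM; apply: filterS => x /=.
  rewrite lee_fin /g; case: ifP => [_ /(_ isT) xM|_ _].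
  - by rewrite le_max xM orbT.
  - by rewrite normr0 le_max lexx.
Qed.

End lebesgue01_lemmas.

Section similarity.
Context (R : realType) (n : nat).
Variables (a c d beta : 'I_n -> R).
Local Notation mu := (@lebesgue01 R).

(* indices start from 0: the k-th interval is ]alpha k, alpha k.+1[ *)
Definition alpha (k : nat) : R := \sum_(i < n | (i < k)%N) a i.

(* for a > 0, at most one k contributes at a given x, and none at the endpoints
   alpha k, which form a null set; see similarity_funE *)
Definition similarity_fun (f : R -> R) (x : R) : R :=
  \sum_(k < n | alpha k < x < alpha k.+1)
    let t := (x - alpha k) / a k in c k * t + d k * f t + beta k.

Lemma alphaS (k : 'I_n) : alpha k.+1 = alpha k + a k.
Proof.
rewrite /alpha (bigD1 k)//= addrC; congr (_ + _).
apply: eq_bigl => i; rewrite ltnS [in RHS]ltn_neqAle andbC.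
by rewrite -(inj_eq val_inj).
Qed.

Lemma le_alpha (k l : nat) : (forall i, 0 < a i) -> (k <= l)%N ->
  alpha k <= alpha l.
Proof.
move=> a0 kl; rewrite /alpha [leRHS]big_mkcond [leLHS]big_mkcond.
apply: ler_sum => i _; case: ifPn => ik; first by rewrite (leq_trans ik).
by case: ifPn => // _; exact: ltW.
Qed.

Lemma similarity_funE (f : R -> R) (k : 'I_n) (t : R) : (forall i, 0 < a i) ->
  0 < t < 1 ->
  similarity_fun f (a k * t + alpha k) = c k * t + d k * f t + beta k.
Proof.
move=> a0 /andP[t0 t1].
have xk : alpha k < a k * t + alpha k < alpha k.+1.
  by rewrite alphaS ltrDr mulr_gt0//= addrC ltrD2l gtr_pMr.
rewrite /similarity_fun (bigD1 k)//= big1 ?addr0; last first.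
  move=> i /andP[/andP[ix xi] ik]; exfalso; case/andP: xk => kx xk.
  have [lt_ik|lt_ki|ik_eq] := ltngtP i k.
  - by have := lt_trans kx xi; rewrite ltNge le_alpha.
  - by have := lt_trans ix xk; rewrite ltNge le_alpha.
  - by rewrite -(inj_eq val_inj)/= ik_eq eqxx in ik.
by rewrite addrK mulrAC divff ?mul1r ?gt_eqF.
Qed.

Lemma similarity_fun_ae (f g : R -> R) : f = g %[ae mu] ->
  similarity_fun f = similarity_fun g %[ae mu].
Proof.
move=> fg.
have H (k : 'I_n) : \forall x \ae mu, alpha k < x < alpha k.+1 ->
    f ((x - alpha k) / a k) = g ((x - alpha k) / a k).
  have [a0|a0] := ltP 0 (a k); last first.
    apply: aeW => x /andP[kx]; rewrite alphaS => /(lt_trans kx).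
    by rewrite ltrDl ltNge a0.
  rewrite alphaS; apply: (@ae_affine _ _ _ (fun x => f x = g x)) => //.
  by apply: filterS fg => x; exact.
have : \forall x \ae mu, forall k : 'I_n, alpha k < x < alpha k.+1 ->
    f ((x - alpha k) / a k) = g ((x - alpha k) / a k).
  exact: filter_forall.
apply: filterS => x fgx _; apply: eq_bigr => k kx /=.
by rewrite fgx.
Qed.

Variables (p : \bar R) (p1 : (1 <= p)%E).

Lemma similarity_fun_Lfun (f : R -> R) :
  f \in Lfun mu p -> similarity_fun f \in Lfun mu p.
Proof.
move=> fp; have [L0 LD] := Lfun_addr_closed mu p1.
have LZ : scaler_closed (Lfun mu p).
  move=> r h hp.
  have [_ /(_ r h 0 hp L0)] := Lfun_submod_closed mu p1.
  by rewrite addr0.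
pose piece (k : 'I_n) (x : R) := if alpha k < x < alpha k.+1 then
  let t := (x - alpha k) / a k in c k * t + d k * f t + beta k else 0.
have -> : similarity_fun f = \sum_(k < n) piece k.
  apply/funext => x; rewrite /similarity_fun big_mkcond fct_sumE.
  by apply: eq_bigr => k _.
apply: (big_ind (fun h : R -> R => h \in Lfun mu p)) => // k _.
have [a0|a0] := ltP 0 (a k); last first.
  rewrite (_ : piece k = 0)//; apply/funext => x; rewrite /piece.
  case: ifPn => // /andP[kx]; rewrite alphaS => /(lt_trans kx).
  by rewrite ltrDl ltNge a0.
pose s x := (x - alpha k) / a k.
pose h x := if alpha k < x < alpha k.+1 then c k * s x + beta k else 0.
pose g x := if alpha k < x < alpha k + a k then f (s x) else 0.
have -> : piece k = h + d k *: g.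
  apply/funext => x; rewrite /piece.
  rewrite -[RHS]/(h x + d k * g x) /h /g -alphaS.
  case: ifPn => _; rewrite ?mulr0 ?addr0//.
  by rewrite addrAC.
apply: LD; last by apply: LZ; exact: Lfun_affine.
apply: (@Lfun_bounded _ _ _ (`|c k| + `|beta k|)) => //.
- have -> : h = (fun x => c k * s x + beta k) \_ `]alpha k, alpha k.+1[.
    by apply/funext => x; rewrite patchE mem_setE in_itv.
  have ms : measurable_fun [set: R] (fun x : R => c k * s x + beta k).
    apply: measurable_funD => //; apply: measurable_funM => //.
    exact: measurable_affine.
  apply/(measurable_restrictT _ (measurable_itv _)).
  exact: measurable_funTS.
- move=> x; rewrite /h; case: ifPn => [/andP[kx xk]|_]; last first.
    by rewrite normr0 addr_ge0.
  rewrite (le_trans (ler_normD _ _))// lerD2r normrM ler_piMr//.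
  rewrite ger0_norm; last by rewrite /s divr_ge0 ?subr_ge0 ?ltW.
  by rewrite ler_pdivrMr// mul1r lerBlDl -alphaS ltW.
Qed.

Definition similarity_op (f : LspaceType mu p1) : LspaceType mu p1 :=
  Lspace_class (Lfun_Sub p1 (similarity_fun_Lfun (Lspace_Lfun f))).

(* the class similarity_op f does not depend on the representative chosen *)
Lemma similarity_opE (f : LspaceType mu p1) (g : R -> R) :
  (f : R -> R) = g %[ae mu] ->
  (similarity_op f : R -> R) = similarity_fun g %[ae mu].
Proof.
move=> fg; apply: ae_eq_trans (similarity_fun_ae fg).
exact: Lspace_classE.
Qed.

End similarity.

(* Main.v *)
From HB Require Import structures.
Require Import Defs.
From mathcomp Require Import all_boot all_order all_algebra.
From mathcomp Require Import all_classical all_reals all_analysis.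
From mathcomp Require Import measurable_realfun ess_sup_inf ring lra.

Set Implicit Arguments.
Unset Strict Implicit.
Unset Printing Implicit Defensive.

Import Order.TTheory GRing.Theory Num.Theory.
Import numFieldNormedType.Exports.

Local Open Scope classical_set_scope.
Local Open Scope ring_scope.

(* Let L be the linear part of G, so that G f - G g = L (f - g). Since the
   branches x = a_k t + alpha_k have disjoint ranges, |L h|^r is the image of
   |h|^r under the same operator with d_k replaced by |d_k|^r, and a change of
   variables gives int |L h|^r <= (sum_k a_k |d_k|^r) int |h|^r; for p = +oo,
   |h| <= M a.e. implies |L h| <= (max_k |d_k|) M a.e. Uniqueness follows at once.
   For existence, completeness of L_p is bypassed: the increments of the
   iterates G^m 0 are dominated a.e. by a geometric sequence times a fixed
   function of L_p, so the iterates converge a.e. to a function of L_p, and a.e.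
   convergence is enough to pass to the limit in G. *)

(** * Geometric domination and almost everywhere convergence *)

(** The sequence is the telescoping series of its increments, which a geometric series dominates.
    The bound on the limit later places the pointwise limit in L_p. *)
Lemma geometric_increment_cvg (R : realType) (u : R^nat) (K l : R) :
  0 <= K -> 0 < l < 1 -> u 0%N = 0 ->
  (forall m, `|u m.+1 - u m| <= K * l ^+ m) ->
  exists2 y : R, u @ \oo --> y & `|y| <= K / (1 - l).
Proof.
move=> K0 /andP[l0 l1] u0 ule.
have l1' : `|l| < 1 by rewrite gtr0_norm.
have uE : u = series (fun m => u m.+1 - u m).
  by apply/funext => m; rewrite /series/= telescope_sumr// u0 subr0.
have cu : cvgn u.
  rewrite uE; apply: normed_cvg.
  apply: (@series_le_cvg _ _ (geometric K l)) => //.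
  - by move=> m; rewrite /= normr_ge0.
  - by move=> m; rewrite geometric_ge0// ltW.
  - exact: is_cvg_geometric_series.
exists (limn u) => //; rewrite ler_norml.
have ub m : `|u m| <= K / (1 - l).
  apply: le_trans (geometric_le_lim m K0 l0 l1').
  rewrite uE (le_trans (ler_norm_sum _ _ _))//.
  by apply: ler_sum => i _; exact: ule.
apply/andP; split.
- by apply: limr_ge => //; apply: nearW => m; have := ub m; rewrite ler_norml => /andP[].
- by apply: limr_le => //; apply: nearW => m; have := ub m; rewrite ler_norml => /andP[].
Qed.

Section Lfun_lemmas.
Context d (T : measurableType d) (R : realType).
Variable mu : {measure set T -> \bar R}.

Lemma measurable_powR_norm (f : T -> R) (r : R) : measurable_fun setT f ->
  measurable_fun setT (fun x => (`|f x| `^ r)%:E).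
Proof.
move=> mf; apply/measurable_EFinP; apply: (measurableT_comp (measurable_powR r)).
exact: measurableT_comp.
Qed.

Lemma Lfun_powR_integral (f : T -> R) (r : R) : 0 < r ->
  (f \in Lfun mu r%:E) <->
  (measurable_fun setT f /\ (\int[mu]_x (`|f x| `^ r)%:E < +oo)%E).
Proof.
move=> r0; rewrite inE; split => [/andP[/[!inE]/= mf ff]|[mf ff]].
- split => //; move: ff; rewrite /finite_norm unlock /Lnorm.
  by apply: lty_poweRy; rewrite gt_eqF ?invr_gt0.
- apply/andP; split; rewrite inE//= /finite_norm unlock /Lnorm.
  exact: poweR_lty.
Qed.

Lemma Lfun_ae_bounded (f : T -> R) : f \in Lfun mu +oo%E -> (0 < mu setT)%E ->
  exists2 M : R, 0 <= M & \forall x \ae mu, `|f x| <= M.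
Proof.
(* The norm at [+oo] is defined by cases on the total mass; [mu0] selects the branch of the
   essential supremum. *)
rewrite inE => /andP[/[!inE]/= mf +] mu0; rewrite /finite_norm unlock /Lnorm mu0.
move=> /ess_supr_bounded[M fM]; exists (Num.max 0 M).
  by rewrite le_max lexx.
by apply: filterS fM => x; rewrite le_max => ->; rewrite orbT.
Qed.

Lemma Lfun_ae_le (p : \bar R) (f g : T -> R) : (1 <= p)%E ->
  measurable_fun setT f -> g \in Lfun mu p ->
  (\forall x \ae mu, `|f x| <= `|g x|) -> f \in Lfun mu p.
Proof.
case: p => [r|_|//].
- rewrite lee_fin => r1 mf; have r0 : 0 < r by rewrite (lt_le_trans ltr01).
  move=> /(Lfun_powR_integral _ r0)[mg gr] fg; apply/Lfun_powR_integral => //.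
  split=> //; apply: le_lt_trans gr; apply: ae_ge0_le_integral => //.
  + exact: measurable_powR_norm.
  + exact: measurable_powR_norm.
  + apply: filterS fg => x fgx _; rewrite lee_fin.
    by apply: ge0_ler_powR => //; rewrite ltW.
- move=> mf gL fg; move: gL; rewrite inE => /andP[]; rewrite !inE/= => mg gg.
  apply/andP; split; rewrite inE//=.
  move: gg; rewrite /finite_norm unlock /Lnorm; case: ifP => // _.
  by apply: le_lt_trans; apply: le_ess_sup; apply: filterS fg => x.
Qed.

(** Summing the increments bounds the limit a.e. by |Q| / (1 - l), a multiple of a function of L_p,
    so domination gives membership for finite and infinite p alike. *)
Lemma Lfun_geometric_cvg (p : \bar R) (u : nat -> T -> R) (Q : T -> R) (l : R) :
  (1 <= p)%E -> (forall m, measurable_fun setT (u m)) -> 0 < l < 1 ->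
  u 0%N = cst 0 -> Q \in Lfun mu p ->
  (\forall x \ae mu, forall m, `|u m.+1 x - u m x| <= `|Q x| * l ^+ m) ->
  exists2 f : T -> R, f \in Lfun mu p & \forall x \ae mu, u ^~ x @ \oo --> f x.
Proof.
move=> p1 mu_ l01 u0 QL uQ.
(* The limsup exists at every point and is measurable, so the divergence set needs no separate
   treatment; [fine] makes it real-valued. *)
pose f x := fine (limn_esup (fun m => (u m x)%:E)).
have mf : measurable_fun setT f.
  apply: (measurableT_comp (fine_measurable measurableT)).
  by apply: (@measurable_fun_limn_esup _ _ _ _ (fun m x => (u m x)%:E)) => m; exact/measurable_EFinP.
have uf : \forall x \ae mu, u ^~ x @ \oo --> f x /\ `|f x| <= `|Q x / (1 - l)|.
  apply: filterS uQ => x uQx.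
  have ux0 : u 0%N x = 0 by rewrite u0.
  have [y uy yQ] := geometric_increment_cvg (normr_ge0 (Q x)) l01 ux0 uQx.
  have -> : f x = y.
    have uyE : (fun m => (u m x)%:E) @ \oo --> y%:E by apply: cvg_EFin => //; exact: nearW.
    rewrite /f is_cvg_limn_esupE; last by apply/cvg_ex; exists y%:E.
    by rewrite (cvg_lim _ uyE).
  split=> //; rewrite normrM [X in _ * X]ger0_norm// invr_ge0 subr_ge0.
  by case/andP: l01 => _ /ltW.
exists f; last by apply: filterS uf => x [].
apply: (@Lfun_ae_le _ _ (fun x => (1 - l)^-1 * Q x)) => //.
- have [_ /(_ (1 - l)^-1 Q 0 QL)] := Lfun_submod_closed mu p1.
  have [L0 _] := Lfun_addr_closed mu p1.
  by move=> /(_ L0); rewrite addr0.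
- by apply: filterS uf => x []; rewrite mulrC.
Qed.

(* |g m| is controlled by the m-th term of the series of |g i|^r / s^i, which
   has a finite integral as soon as q < s; this avoids Minkowski's inequality *)
Lemma Lfun_geometric_dominated (r q C : R) (g : nat -> T -> R) :
  0 < r -> (forall m, measurable_fun setT (g m)) -> 0 <= q < 1 ->
  (forall m, (\int[mu]_x (`|g m x| `^ r)%:E <= (C * q ^+ m)%:E)%E) ->
  exists2 l : R, 0 < l < 1 & exists2 Q : T -> R, Q \in Lfun mu r%:E &
    \forall x \ae mu, forall m, `|g m x| <= `|Q x| * l ^+ m.
Proof.
move=> r0 mg /andP[q0 q1] gq.
(* Any ratio strictly between q and 1 would do: q < s makes the weighted series of integrals
   converge, s < 1 leaves geometric decay. *)
have [s qs s1] : exists2 s, q < s & s < 1 by exists ((1 + q) / 2); lra.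
have s0 : 0 < s by exact: le_lt_trans qs.
have C0 : 0 <= C.
  have := gq 0%N; rewrite expr0 mulr1 -lee_fin; apply: le_trans.
  by apply: integral_ge0 => x _; rewrite lee_fin powR_ge0.
pose h m x := ((s ^- m)%:E * (`|g m x| `^ r)%:E)%E.
have h0 m x : (0 <= h m x)%E.
  by rewrite mule_ge0// lee_fin ?powR_ge0// invr_ge0 exprn_ge0// ltW.
have mh m : measurable_fun setT (h m).
  by apply: measurable_funeM; exact: measurable_powR_norm.
pose H x := (\sum_(m <oo) h m x)%E.
have H0 x : (0 <= H x)%E by exact: nneseries_ge0.
have mH : measurable_fun setT H by exact: ge0_emeasurable_sum.
have Hoo : (\int[mu]_x H x < +oo)%E.
  rewrite integral_nneseries//.
  apply: (@le_lt_trans _ _ (C * (1 - q / s)^-1)%:E); last exact: ltry.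
  apply: lime_le; first by apply: is_cvg_nneseries => m _ _; exact: integral_ge0.
  apply: nearW => m.
  have qs1 : `|q / s| < 1.
    by rewrite ger0_norm ?divr_ge0 ?(ltW s0)// ltr_pdivrMr// mul1r.
  apply: (@le_trans _ _ (series (geometric C (q / s)) m)%:E); last first.
    (* [geometric_le_lim] wants a positive ratio; for q = 0 the partial sum is empty or reduces to
       its first term C. *)
    rewrite lee_fin; have [->|qn0] := eqVneq q 0; last first.
      by apply: geometric_le_lim => //; rewrite divr_gt0// lt_def qn0.
    rewrite mul0r subr0 invr1 mulr1 /series/=.
    case: m => [|m]; first by rewrite big_geq.
    rewrite big_nat_recl//= expr0 mulr1 big1 ?addr0// => i _.
    by rewrite expr0n mulr0.
  rewrite /series/= -sumEFin; apply: lee_sum => i _.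
  rewrite ge0_integralZl_EFin//; last 2 first.
  - exact: measurable_powR_norm.
  - by rewrite invr_ge0 exprn_ge0// ltW.
  apply: (@le_trans _ _ ((s ^- i)%:E * (C * q ^+ i)%:E)%E).
    by rewrite lee_wpmul2l// lee_fin invr_ge0 exprn_ge0// ltW.
  by rewrite -EFinM lee_fin expr_div_n mulrC mulrA.
(* The inequality |g m|^r <= H * s^m will be read after taking r-th roots, whence l = s^(1/r) and Q
   = H^(1/r). *)
exists (s `^ r^-1).
  rewrite powR_gt0//= (_ : 1 = 1 `^ r^-1); last by rewrite powR1.
  by rewrite gt0_ltr_powR ?invr_gt0// nnegrE// ltW.
exists (fun x => fine (H x) `^ r^-1).
  apply/Lfun_powR_integral => //; split.
    apply: (measurableT_comp (measurable_powR _)).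
    exact: (measurableT_comp (fine_measurable measurableT)).
  apply: le_lt_trans Hoo; apply: ge0_le_integral => //.
  - apply: measurable_powR_norm; apply: (measurableT_comp (measurable_powR _)).
    exact: (measurableT_comp (fine_measurable measurableT)).
  (* Where H is infinite, [fine] gives 0 and the inequality still holds. *)
  - move=> x _; rewrite ger0_norm ?powR_ge0// -powRrM mulVf ?gt_eqF// powRr1.
      by case: (H x) (H0 x) => //= y _; exact: leey.
    exact: fine_ge0.
have : mu.-integrable setT H.
  apply/integrableP; split => //.
  by under eq_integral do rewrite gee0_abs//.
move=> /(integrable_ae measurableT); apply: filterS => x /(_ I) Hx m.
(* A single term of a nonnegative series is at most its sum, which is finite at this x. *)
have hH : (h m x <= H x)%E.
  rewrite /H (nneseriesD1 (n := m))//= leeDl//; exact: nneseries_ge0.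
rewrite [in leRHS]ger0_norm ?powR_ge0//.
have : `|g m x| `^ r <= fine (H x) * s ^+ m.
  move: hH; rewrite -[H x]fineK// /h -EFinM lee_fin mulrC.
  by rewrite ler_pdivrMr ?exprn_gt0.
move=> /(ge0_ler_powR (ltW (eqbRL (invr_gt0 r) r0))).
rewrite !nnegrE powR_ge0 mulr_ge0 ?fine_ge0 ?exprn_ge0 ?(ltW s0)// => /(_ isT isT).
rewrite -powRrM divff ?gt_eqF// powRr1// powRM ?fine_ge0 ?exprn_ge0 ?(ltW s0)//.
by rewrite -!powR_mulrn ?powR_ge0 ?(ltW s0)// powRAC.
Qed.

End Lfun_lemmas.

(** * Change of variables and contraction estimates for the similarity operator *)

(** Only an inequality, because ]b, b + a[ may leave [0, 1]: the restricted measure is first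
    enlarged to the full Lebesgue measure, whose image under x |-> (x - b) / a is a times Lebesgue
    measure. *)
Lemma ge0_integral_affine_le (R : realType) (a b : R) (h : R -> R) : 0 < a ->
  measurable_fun setT h -> (forall x, 0 <= h x) ->
  (\int[@lebesgue01 R]_x (if (b < x < b + a)%R then h ((x - b) / a) else 0)%:E <=
   a%:E * \int[@lebesgue01 R]_x (h x)%:E)%E.
Proof.
move=> a0 mh h0; set mu := @lebesgue01 R.
pose s x : R := (x - b) / a; pose I := `]b, (b + a)[%classic.
have ms : measurable_fun setT s by exact: measurable_affine.
have sI : I = s @^-1` `]0, 1[.
  apply/seteqP; split => z /=; rewrite !in_itv/= /s ltr_pdivlMr// ltr_pdivrMr//;
  by rewrite mul0r mul1r subr_gt0 ltrBlDl.
pose e x := (h x)%:E.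
have me : measurable_fun setT e by exact/measurable_EFinP.
have e0 x : (0 <= e x)%E by rewrite lee_fin.
rewrite [leLHS](_ : _ = \int[mu]_(x in I) (e \o s) x)%E; last first.
  rewrite [RHS]integral_mkcond; apply: eq_integral => x _.
  by rewrite patchE /= mem_setE/= in_itv/=; case: ifPn.
apply: (@le_trans _ _ (\int[lebesgue_measure]_(x in I) (e \o s) x)%E).
  apply: ge0_le_measure_integral => //.
  - by move=> S mS; apply: le_measure; rewrite ?inE//; exact: measurableI.
  - exact: measurable_itv.
  - by move=> x; exact: e0.
  - exact: (measurableT_comp me ms).
have a0' := ltW a0.
rewrite sI -[leLHS](@ge0_integral_pushforward _ _ (measurableTypeR R)
   (measurableTypeR R))//=; last exact: measurable_funTS.
(* Inside ]0, 1[ the restriction to [0, 1] is invisible, so the image measure agrees there with a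
   times [mu]. *)
rewrite [leLHS](_ : _ =
    \int[mscale (NngNum a0') mu]_(y in `]0%R, 1%R[) e y)%E; last first.
  pose phi : {mfun measurableTypeR R >-> measurableTypeR R} :=
    HB.pack s (isMeasurableFun.Build _ _ (measurableTypeR R) (measurableTypeR R) _ ms).
  apply: (@eq_measure_integral _ _ _ _ _ (pushforward lebesgue_measure phi)) => A mA A01.
  rewrite [RHS](_ : _ = a%:E * lebesgue_measure (A `&` `[0%R, 1%R]))%E; last by [].
  rewrite setIidl; first exact: lebesgue_measure_affine.
  apply: (subset_trans A01) => x /=; rewrite !in_itv/= => /andP[x0 x1].
  by rewrite !ltW.
rewrite ge0_integral_mscale//; last exact: measurable_funTS.
by apply: lee_wpmul2l; [rewrite lee_fin|exact: ge0_subset_integral].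
Qed.

Section similarity_contraction.
Context (R : realType) (n : nat) (a : 'I_n -> R).
Hypothesis a_gt0 : forall k, 0 < a k.
Local Notation mu := (@lebesgue01 R).
Local Notation lin d := (similarity_fun a (fun=> 0) d (fun=> 0)).

(** Pointwise identities reduce to a single branch. The parameters and the function are quantified
    inside each case so that one branch index serves several operators at the same x. *)
Lemma similarity_fun_cases (x : R) :
  (exists2 k : 'I_n, alpha a k < x < alpha a k.+1 &
    forall c d beta f, let t := (x - alpha a k) / a k in
      similarity_fun a c d beta f x = c k * t + d k * f t + beta k) \/
  (forall c d beta f, similarity_fun a c d beta f x = 0).
Proof.
have [/existsP[k kx]|nk] := boolP [exists k : 'I_n, alpha a k < x < alpha a k.+1].
- left; exists k => // c d beta f t.
  have t01 : 0 < t < 1.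
    move: kx; rewrite alphaS /t ltr_pdivlMr// ltr_pdivrMr//.
    by rewrite mul0r mul1r subr_gt0 ltrBlDl.
  have -> : x = a k * t + alpha a k.
    by rewrite /t mulrC divfK ?gt_eqF// subrK.
  exact: similarity_funE.
- right=> c d beta f; rewrite /similarity_fun big_pred0// => k.
  by apply/negbTE; apply: contra nk => kx; apply/existsP; exists k.
Qed.

Lemma similarity_funB (c d beta : 'I_n -> R) (f g : R -> R) (x : R) :
  similarity_fun a c d beta f x - similarity_fun a c d beta g x =
  lin d (fun y => f y - g y) x.
Proof.
have [[k _ E]|E] := similarity_fun_cases x; rewrite !E ?subrr//.
by rewrite mul0r add0r addr0; ring.
Qed.

Lemma powR_norm_similarity (d : 'I_n -> R) (h : R -> R) (r x : R) : 0 < r ->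
  `|lin d h x| `^ r = lin (fun k => `|d k| `^ r) (fun y => `|h y| `^ r) x.
Proof.
move=> r0; have [[k _ E]|E] := similarity_fun_cases x; rewrite !E; last first.
  by rewrite normr0 powR0// gt_eqF.
by rewrite !mul0r !add0r !addr0 normrM powRM.
Qed.

Lemma ge0_integral_similarity_le (w : 'I_n -> R) (h : R -> R) :
  (forall k, 0 <= w k) -> measurable_fun setT h -> (forall x, 0 <= h x) ->
  (\int[mu]_x (lin w h x)%:E <=
   (\sum_(k < n) a k * w k)%:E * \int[mu]_x (h x)%:E)%E.
Proof.
move=> w0 mh h0.
(* The contribution of one branch without its weight, in the form handled by
   [ge0_integral_affine_le]. *)
pose piece (k : 'I_n) x := if alpha a k < x < alpha a k + a k then
  h ((x - alpha a k) / a k) else 0.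
have piece0 k x : 0 <= piece k x by rewrite /piece; case: ifP.
have mpiece k : measurable_fun setT (fun x => (piece k x)%:E).
  have -> : (fun x => (piece k x)%:E) =
      (fun x => (h ((x - alpha a k) / a k))%:E) \_ `]alpha a k, alpha a k + a k[.
    by apply/funext => x; rewrite patchE mem_setE in_itv/= /piece; case: ifP.
  apply/(measurable_restrictT _ (measurable_itv _)); apply: measurable_funTS.
  apply/measurable_EFinP; apply: measurableT_comp mh _.
  exact: measurable_affine.
rewrite [leLHS](_ : _ = \int[mu]_x \sum_(k < n) ((w k)%:E * (piece k x)%:E))%E; last first.
  apply: eq_integral => x _; rewrite /similarity_fun big_mkcond -sumEFin.
  apply: eq_bigr => k _; rewrite -EFinM /piece -alphaS.
  by case: ifP => _ /=; rewrite ?mulr0// mul0r add0r addr0.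
rewrite ge0_integral_sum//; last 2 first.
- by move=> k; apply: measurable_funeM; exact: mpiece.
- by move=> k x _; rewrite mule_ge0// lee_fin.
rewrite -sumEFin ge0_sume_distrl//; last by move=> k _; rewrite lee_fin mulr_ge0// ltW.
apply: lee_sum => k _; rewrite ge0_integralZl_EFin//; last 2 first.
- by move=> x _; rewrite lee_fin.
- exact: mpiece.
rewrite [(a k * w k)%R]mulrC EFinM -muleA; apply: lee_wpmul2l; first by rewrite lee_fin.
exact: ge0_integral_affine_le.
Qed.

Lemma integral_powR_similarity_le (d : 'I_n -> R) (h : R -> R) (r : R) : 0 < r ->
  measurable_fun setT h ->
  (\int[mu]_x (`|lin d h x| `^ r)%:E <=
   (\sum_(k < n) a k * `|d k| `^ r)%:E * \int[mu]_x (`|h x| `^ r)%:E)%E.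
Proof.
move=> r0 mh; under eq_integral do rewrite powR_norm_similarity//.
apply: ge0_integral_similarity_le => //.
exact/measurable_EFinP/measurable_powR_norm.
Qed.

(** Each branch pulls a null set back to a null set, and there are finitely many branches, so one
    exceptional set serves them all. *)
Lemma ae_similarity (P : set R) : (\forall x \ae mu, P x) ->
  \forall x \ae mu, forall k : 'I_n, alpha a k < x < alpha a k.+1 ->
    P ((x - alpha a k) / a k).
Proof.
by move=> aeP; apply: filter_forall => k; rewrite alphaS; exact: ae_affine.
Qed.

Lemma ae_similarity_le (d : 'I_n -> R) (h : R -> R) (q M : R) :
  0 <= M -> 0 <= q -> (forall k, `|d k| <= q) -> (\forall x \ae mu, `|h x| <= M) ->
  \forall x \ae mu, `|lin d h x| <= q * M.
Proof.
move=> M0 q0 dq /ae_similarity; apply: filterS => x hM.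
have [[k kx E]|E] := similarity_fun_cases x; rewrite E.
  by rewrite mul0r add0r addr0 normrM ler_pM//; exact: hM.
by rewrite normr0 mulr_ge0.
Qed.

(** For a.e. x the iterates converge both at x and at its preimage t under the branch through x;
    letting m tend to infinity in u_(m+1)(x) = c_k t + d_k u_m(t) + beta_k gives two limits, equal
    by uniqueness. *)
Lemma similarity_fun_ae_cvg (c d beta : 'I_n -> R) (u : nat -> R -> R) (f : R -> R) :
  (forall m, u m.+1 = similarity_fun a c d beta (u m)) ->
  (\forall x \ae mu, u ^~ x @ \oo --> f x) ->
  similarity_fun a c d beta f = f %[ae mu].
Proof.
move=> uS uf; have := ae_similarity uf.
apply: filterS2 uf => x ux utx _.
have uSx : (fun m => u m.+1 x) @ \oo --> f x.
  by have := ux; rewrite -(cvg_shiftS (u ^~ x)).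
apply: (cvg_unique _ _ uSx) => //=.
under eq_fun do rewrite uS.
have [[k kx E]|E] := similarity_fun_cases x; rewrite E; last first.
  by under eq_fun do rewrite E; exact: cvg_cst.
under eq_fun do rewrite E.
apply: cvgD; last exact: cvg_cst.
apply: cvgD; first exact: cvg_cst.
by apply: cvgM; [exact: cvg_cst|exact: utx].
Qed.

End similarity_contraction.

(** * Fixed points up to a.e. equality: uniqueness, then existence *)

Section similarity_fixpoint.
Context (R : realType) (n : nat) (a c d beta : 'I_n -> R).
Hypothesis a_gt0 : forall k, 0 < a k.
Variables (p : \bar R) (p1 : (1 <= p)%E).
Hypothesis d_fin : forall r : R, p = r%:E -> \sum_(k < n) a k * `|d k| `^ r < 1.
Hypothesis d_infty : p = +oo%E -> \big[Num.max/0]_(k < n) `|d k| < 1.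
Local Notation mu := (@lebesgue01 R).
Local Notation S := (similarity_fun a c d beta).
Local Notation lin := (similarity_fun a (fun=> 0) d (fun=> 0)).

(** Common starting point of uniqueness and existence. The contraction concerns the integral of
    |h|^r without its root, or a.e. bounds in place of the essential supremum. *)
Lemma similarity_contraction_cases :
  (exists r q : R, [/\ p = r%:E, 0 < r, 0 <= q < 1 &
    forall h : R -> R, measurable_fun setT h ->
      (\int[mu]_x (`|lin h x| `^ r)%:E <= q%:E * \int[mu]_x (`|h x| `^ r)%:E)%E]) \/
  (exists q : R, [/\ p = +oo%E, 0 <= q < 1 &
    forall (h : R -> R) (M : R), 0 <= M -> (\forall x \ae mu, `|h x| <= M) ->
      \forall x \ae mu, `|lin h x| <= q * M]).
Proof.
case: p p1 d_fin d_infty => [r r1 /(_ r erefl) q1 _|_ _ /(_ erefl) q1|//].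
- left; exists r, (\sum_(k < n) a k * `|d k| `^ r).
  have r0 : 0 < r by rewrite (lt_le_trans ltr01).
  split=> //; last by move=> h; exact: integral_powR_similarity_le.
  by rewrite q1 andbT sumr_ge0// => k _; rewrite mulr_ge0// ?powR_ge0// ltW.
- right; exists (\big[Num.max/0]_(k < n) `|d k|); split=> //.
    by rewrite q1 andbT; elim/big_ind: _ => // x y x0 _; rewrite le_max x0.
  move=> h M M0; apply: ae_similarity_le => //.
    by elim/big_ind: _ => // x y x0 _; rewrite le_max x0.
  by move=> k; rewrite (bigD1 k)//= le_max lexx.
Qed.

Lemma lin_ae_fixpoint_eq0 (h : R -> R) : h \in Lfun mu p ->
  lin h = h %[ae mu] -> h = cst 0 %[ae mu].
Proof.
move=> hp hE.
have [[r [q [pE r0 /andP[q0 q1] lip]]]|[q [pE /andP[q0 q1] lip]]] :=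
    similarity_contraction_cases.
- have mlh : measurable_fun setT (lin h).
    have := similarity_fun_Lfun a (fun=> 0) d (fun=> 0) p1 hp.
    by rewrite inE => /andP[]; rewrite inE.
  move: hp; rewrite pE => /(Lfun_powR_integral _ _ r0)[mh hoo].
  have mhr := measurable_powR_norm r mh.
  set I := (\int[mu]_x (`|h x| `^ r)%:E)%E in hoo.
  have I0 : (0 <= I)%E by apply: integral_ge0.
  have Iq : (I <= q%:E * I)%E.
    apply: le_trans (lip _ mh); apply: ae_ge0_le_integral => //.
      exact: measurable_powR_norm.
    by apply: filterS hE => x /(_ Logic.I) -> _.
  (* Since I is finite and q < 1, I <= q * I forces I = 0. *)
  have {}I0 : I = 0%E.
    have IE : I = (fine I)%:E by rewrite fineK// ge0_fin_numE.
    move: I0 Iq; rewrite IE -EFinM !lee_fin => I0 Iq; congr EFin; nra.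
  have : (\int[mu]_x `|(`|h x| `^ r)%:E| = 0)%E.
    by rewrite -I0; apply: eq_integral => x _; rewrite gee0_abs// lee_fin powR_ge0.
  move/(ae_eq_integral_abs mu measurableT mhr); apply: filterS => x /(_ Logic.I)/= [].
  by move=> /powR_eq0_eq0/eqP; rewrite normr_eq0 => /eqP.
- move: hp; rewrite pE => hoo.
  have mu0 : (0 < mu setT)%E by rewrite lebesgue01_setT.
  have [M M0 hM] := Lfun_ae_bounded hoo mu0.
  (* Each replacement of h by its a.e. equal image improves the bound by a factor q; countably many
     null sets are then merged. *)
  have hqM m : \forall x \ae mu, `|h x| <= q ^+ m * M.
    elim: m => [|m IH]; first by apply: filterS hM => x; rewrite expr0 mul1r.
    have /lip := IH; rewrite mulr_ge0// ?exprn_ge0// => /(_ isT).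
    by apply: filterS2 hE => x /(_ Logic.I) ->; rewrite exprS mulrA.
  have := ae_foralln hqM; apply: filterS => x hx _.
  apply/eqP; rewrite -normr_le0.
  have q1' : `|q| < 1 by rewrite ger0_norm.
  have cq : (fun m => q ^+ m * M) @ \oo --> (0 : R).
    rewrite -(mul0r M); apply: cvgM; last exact: cvg_cst.
    exact: cvg_expr.
  rewrite -(cvg_lim _ cq)//; apply: limr_ge.
    by apply/cvg_ex; exists 0.
  exact: nearW.
Qed.

(** The difference of two fixed points is a fixed point of the linear part, hence vanishes a.e. *)
Lemma similarity_fun_ae_unique (f g : R -> R) :
  f \in Lfun mu p -> g \in Lfun mu p ->
  S f = f %[ae mu] -> S g = g %[ae mu] -> f = g %[ae mu].
Proof.
move=> fL gL Sf Sg.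
have [_ /(_ (-1) g f gL fL) fgL] := Lfun_submod_closed mu p1.
have : (fun x => f x - g x) = cst 0 %[ae mu].
  apply: lin_ae_fixpoint_eq0.
    by rewrite (_ : (fun _ => _) = -1 *: g + f)//; apply/funext => x /=; rewrite scaleN1r addrC.
  apply: filterS2 Sf Sg => x /(_ I) Sf /(_ I) Sg _.
  by rewrite -(similarity_funB a_gt0 c d beta) Sf Sg.
by apply: filterS => x /(_ I)/= fg _; apply/eqP; rewrite -subr_eq0 fg.
Qed.

Lemma similarity_fun_ae_exists :
  exists2 f : R -> R, f \in Lfun mu p & S f = f %[ae mu].
Proof.
pose u m := iter m S (cst 0).
have [L0 _] := Lfun_addr_closed mu p1.
have uL m : u m \in Lfun mu p.
  by elim: m => [//|m IH]; exact: similarity_fun_Lfun.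
have mu_ m : measurable_fun setT (u m).
  by have := uL m; rewrite inE => /andP[]; rewrite inE.
pose g m x := u m.+1 x - u m x.
have gS m : g m.+1 = lin (g m).
  by apply/funext => x; exact: similarity_funB.
have mg m : measurable_fun setT (g m) by exact: measurable_funB.
(* Both regimes of p only have to dominate the increments g m, which the linear part maps each to
   the next. *)
suff [l l01 [Q QL gQ]] : exists2 l : R, 0 < l < 1 & exists2 Q : R -> R,
    Q \in Lfun mu p & \forall x \ae mu, forall m, `|g m x| <= `|Q x| * l ^+ m.
  have [f fL uf] := @Lfun_geometric_cvg _ (measurableTypeR R) _ mu p u Q l p1
    mu_ l01 erefl QL gQ.
  exists f => //; exact: (similarity_fun_ae_cvg a_gt0 (u := u)).
have g0L : g 0%N \in Lfun mu p.
  have [_ /(_ (-1) (u 0%N) (u 1%N))] := Lfun_submod_closed mu p1.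
  move=> /(_ (uL 0%N) (uL 1%N)).
  rewrite (_ : g 0%N = -1 *: u 0%N + u 1%N)//.
  by apply/funext => x; rewrite /g addrC -scaleN1r.
have [[r [q [pE r0 q01 lip]]]|[q [pE /andP[q0 q1] lip]]] :=
    similarity_contraction_cases.
- rewrite pE; move: g0L; rewrite pE => /(Lfun_powR_integral _ _ r0)[_ g0oo].
  set C := (\int[mu]_x (`|g 0%N x| `^ r)%:E)%E in g0oo.
  have CE : C = (fine C)%:E.
    by rewrite fineK// ge0_fin_numE//; apply: integral_ge0.
  apply: (@Lfun_geometric_dominated _ (measurableTypeR R) _ mu r q (fine C)) => // m.
  elim: m => [|m IH]; first by rewrite expr0 mulr1 -CE.
  rewrite gS; apply: le_trans (lip _ (mg m)) _.
  apply: (@le_trans _ _ (q%:E * (fine C * q ^+ m)%:E)%E).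
    by apply: lee_wpmul2l => //; rewrite lee_fin; case/andP: q01.
  by rewrite -EFinM exprS mulrCA.
- rewrite pE; move: g0L; rewrite pE => g0L.
  have mu0 : (0 < mu setT)%E by rewrite lebesgue01_setT.
  have [M M0 gM] := Lfun_ae_bounded g0L mu0.
  have gqM m : \forall x \ae mu, `|g m x| <= q ^+ m * M.
    elim: m => [|m IH].
      by apply: filterS gM => x; rewrite expr0 mul1r.
    rewrite gS; have /lip := IH; rewrite mulr_ge0// ?exprn_ge0// => /(_ isT).
    by apply: filterS => x; rewrite exprS mulrA.
  (* The ratio q may be 0 while l must be positive, so q is enlarged to a midpoint. *)
  have [l ql l1] : exists2 l, q < l & l < 1 by exists ((1 + q) / 2); lra.
  exists l; first by rewrite l1 andbT (le_lt_trans q0).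
  exists (cst M); first exact: (@Lfun_bounded _ +oo%E (cst M) `|M| (leey 1) (measurable_cst M) (fun=> lexx _)).
  have := ae_foralln gqM; apply: filterS => x gx m.
  apply: le_trans (gx m) _; rewrite /= ger0_norm// mulrC ler_wpM2l//.
  by rewrite lerXn2r// ?nnegrE// ltW// (le_lt_trans q0).
Qed.

End similarity_fixpoint.

(** * From functions to classes modulo a.e. equality *)

Theorem mainTheorem2 (R : realType) (n : nat) (n1 : (1 < n)%N)
    (a c d beta : 'I_n -> R)
    (a_gt0 : forall k, 0 < a k) (a_sum1 : \sum_(k < n) a k = 1)
    (p : \bar R) (p1 : (1 <= p)%E)
    (d_fin : forall r : R, p = r%:E -> \sum_(k < n) a k * `|d k| `^ r < 1)
    (d_infty : p = +oo%E -> \big[Num.max/0]_(k < n) `|d k| < 1) :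
  exists! f : LspaceType (@lebesgue01 R) p1, similarity_op a c d beta f = f.
Proof.
have [f fL Sf] := similarity_fun_ae_exists c beta a_gt0 p1 d_fin d_infty.
have fE := Lspace_classE (Lfun_Sub p1 fL).
exists (Lspace_class (Lfun_Sub p1 fL)); split.
- apply/Lspace_eqP; apply: ae_eq_trans (similarity_opE _ _ _ _ fE) _.
  by apply: ae_eq_trans Sf _; exact: ae_eq_sym.
- move=> g Gg; apply/Lspace_eqP; apply: ae_eq_trans fE _.
  apply: (similarity_fun_ae_unique a_gt0 p1 d_fin d_infty fL (Lspace_Lfun g) Sf).
  (* With g as its own representative, the equality of classes [Gg] becomes an a.e. fixed-point
     equation for functions. *)
  have := similarity_opE a c d beta (ae_eq_refl (@lebesgue01 R) setT (g : R -> R)).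
  by rewrite Gg; exact: ae_eq_sym.
Qed.
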